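(* Let $\lambda\in\mathbf{C}$ with $\lambda\neq 1$, and let $n\ge 0$ and $r\ge 0$ be integers. Let $p(x)\in\mathbb{P}_n(\lambda)$ and write $$p(x)=\sum_{k=0}^{n}C_k H_k^{(r)}(x\vert\lambda),\qquad C_k\in\mathbf{Q}(\lambda).$$ Then for every $0\le k\le n$, $$C_k=\frac{1}{k!(1-\lambda)^r}\sum_{j=0}^{r}\binom{r}{j}(-\lambda)^{r-j}\,D^kp(j),$$ where $Dp(x)=\frac{dp(x)}{dx}$ and $D^kp(j)$ is the value at $x=j$ of the $k$-th derivative of $p$.
   Context: The Frobenius-Euler polynomials of order $r$ ($r$ a nonnegative integer), $H_n^{(r)}(x\vert\lambda)$, are defined by the formal power series identity $\left(\frac{1-\lambda}{e^t-\lambda}\right)^r e^{xt}=\sum_{n=0}^\infty H_n^{(r)}(x\vert\lambda)\frac{t^n}{n!}$. The polynomial $H_n^{(r)}(x\vert\lambda)$ is monic of degree $n$ in $x$ with coefficients in the field $\mathbf{Q}(\lambda)$. $\mathbb{P}_n(\lambda)=\{p(x)\in\mathbf{Q}(\lambda)[x] : \deg p(x)\le n\}$, an $(n+1)$-dimensional vector space over $\mathbf{Q}(\lambda)$, of which $\{H_0^{(r)}(x\vert\lambda),\dots,H_n^{(r)}(x\vert\lambda)\}$ is a basis. Convention: $0^0=1$. *)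

(* Defs.v *)
From HB Require Import structures.
From mathcomp Require Import all_boot all_order all_algebra.
From mathcomp Require Import boolp reals.
From mathcomp Require Import complex.

Set Implicit Arguments.
Unset Strict Implicit.
Unset Printing Implicit Defensive.

Import GRing.Theory.
Local Open Scope ring_scope.

Record fps (K : comUnitRingType) := Fps { coeft : nat -> K }.

Section FormalPowerSeries.
Variable K : comUnitRingType.
Implicit Types f g h : fps K.

Lemma fps_ext f g : coeft f =1 coeft g -> f = g.
Proof. by case: f g => [f] [g] /= /funext ->. Qed.

HB.instance Definition _ := gen_eqMixin (fps K).
HB.instance Definition _ := gen_choiceMixin (fps K).

Definition fps_zero : fps K := Fps (fun=> 0).
Definition fps_opp f : fps K := Fps (fun n => - coeft f n).
Definition fps_add f g : fps K := Fps (fun n => coeft f n + coeft g n).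
Definition fps_const (c : K) : fps K := Fps (fun n => if n == 0%N then c else 0).
Definition fps_mul f g : fps K :=
  Fps (fun n => \sum_(i < n.+1) coeft f i * coeft g (n - i)).

Fact fps_addA : associative fps_add.
Proof. by move=> f g h; apply: fps_ext => n /=; rewrite addrA. Qed.
Fact fps_addC : commutative fps_add.
Proof. by move=> f g; apply: fps_ext => n /=; rewrite addrC. Qed.
Fact fps_add0 : left_id fps_zero fps_add.
Proof. by move=> f; apply: fps_ext => n /=; rewrite add0r. Qed.
Fact fps_addN : left_inverse fps_zero fps_opp fps_add.
Proof. by move=> f; apply: fps_ext => n /=; rewrite addNr. Qed.

HB.instance Definition _ :=
  GRing.isZmodule.Build (fps K) fps_addA fps_addC fps_add0 fps_addN.

Definition fps_trunc N f : {poly K} := \poly_(i < N) coeft f i.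

Fact coeft_mul_trunc N f g n : (n < N)%N ->
  coeft (fps_mul f g) n = (fps_trunc N f * fps_trunc N g)`_n.
Proof.
move=> ltnN; rewrite coefM; apply: eq_bigr => i _.
rewrite !coef_poly (leq_ltn_trans (leq_subr i n) ltnN).
by rewrite (leq_trans (ltn_ord i) ltnN).
Qed.

Fact fps_mulC : commutative fps_mul.
Proof.
by move=> f g; apply: fps_ext => n; rewrite !(@coeft_mul_trunc n.+1) // mulrC.
Qed.

Fact fps_mulA : associative fps_mul.
Proof.
move=> f g h; apply: fps_ext => n /=; pose T := fps_trunc n.+1.
transitivity ((T f * (T g * T h))`_n).
  rewrite coefM; apply: eq_bigr => i _.
  rewrite -(@coeft_mul_trunc n.+1) ?ltnS ?leq_subr //.
  by rewrite coef_poly ltn_ord.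
rewrite mulrA coefM; apply: eq_bigr => i _.
rewrite -(@coeft_mul_trunc n.+1) ?ltn_ord //.
by rewrite coef_poly ltnS leq_subr.
Qed.

Fact fps_mul1 : left_id (fps_const 1) fps_mul.
Proof.
move=> f; apply: fps_ext => n /=; rewrite big_ord_recl /= mul1r subn0.
by rewrite big1 ?addr0 // => i _; rewrite mul0r.
Qed.

Fact fps_mulDl : left_distributive fps_mul fps_add.
Proof.
move=> f g h; apply: fps_ext => n /=; rewrite -big_split /=.
by apply: eq_bigr => i _; rewrite mulrDl.
Qed.

Fact fps_1neq0 : fps_const 1 != 0.
Proof.
by apply/eqP => /(congr1 (fun f => coeft f 0)) /= /eqP; rewrite oner_eq0.
Qed.

HB.instance Definition _ := GRing.Zmodule_isComNzRing.Build (fps K)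
  fps_mulA fps_mulC fps_mul1 fps_mulDl fps_1neq0.

(* The first n coefficients of 1 / f: the m-th one is determined by the      *)
(* previous ones through the m-th coefficient of the equation (1 / f) f = 1. *)
Fixpoint fps_inv_seq f n : seq K :=
  if n is m.+1 then
    let s := fps_inv_seq f m in
    rcons s (((m == 0%N)%:R - \sum_(i < m) s`_i * coeft f (m - i))
             / coeft f 0)
  else [::].

Definition fps_unit : {pred fps K} := fun f => coeft f 0 \is a GRing.unit.
Definition fps_inv f : fps K :=
  if fps_unit f then Fps (fun n => (fps_inv_seq f n.+1)`_n) else f.

Fact size_fps_inv_seq f n : size (fps_inv_seq f n) = n.
Proof. by elim: n => //= n IHn; rewrite size_rcons IHn. Qed.

Fact nth_fps_inv_seq f n i : (i < n)%N ->
  (fps_inv_seq f n)`_i = (fps_inv_seq f i.+1)`_i.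
Proof.
elim: n => // n IHn; rewrite ltnS leq_eqVlt => /predU1P[-> // | ltin].
by rewrite [LHS]/= nth_rcons size_fps_inv_seq ltin IHn.
Qed.

Fact fps_mulV : {in fps_unit, left_inverse 1 fps_inv *%R}.
Proof.
move=> f Uf; apply: fps_ext => n; rewrite /fps_inv ifT //.
rewrite [LHS]/= big_ord_recr subnn; set s := fps_inv_seq f.
have ->: (s n.+1)`_n =
    ((n == 0%N)%:R - \sum_(i < n) (s n)`_i * coeft f (n - i)) / coeft f 0.
  by rewrite /= nth_rcons size_fps_inv_seq ltnn eqxx.
rewrite divrK //.
have ->: \sum_(i < n) (s n)`_i * coeft f (n - i) =
         \sum_(i < n) (s i.+1)`_i * coeft f (n - i).
  by apply: eq_bigr => i _; rewrite [in LHS]/s nth_fps_inv_seq.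
by rewrite [LHS]addrC subrK /=; case: eqP.
Qed.

Fact fps_unitPl f g : g * f = 1 -> fps_unit f.
Proof.
move=> /(congr1 (fun u => coeft u 0)) /=; rewrite big_ord1 /= => gf1.
by apply/unitrPr; exists (coeft g 0); rewrite mulrC.
Qed.

Fact fps_inv_out : {in [predC fps_unit], fps_inv =1 id}.
Proof. by move=> f /negPf; rewrite /fps_inv /in_mem /= => ->. Qed.

HB.instance Definition _ := GRing.ComNzRing_hasMulInverse.Build (fps K)
  fps_mulV fps_unitPl fps_inv_out.

(* e^(a t), as a power series in t; meaningful when K contains the rationals. *)
Definition fps_exp (a : K) : fps K := Fps (fun n => a ^+ n / n`!%:R).

End FormalPowerSeries.

Section FrobeniusEuler.
Variable R : realType.
Local Notation C := R[i].
Implicit Types (lambda : C) (r n : nat).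

(* The variable t is that of fps and x is that of {poly C}. *)
Definition frobenius_euler_gf r lambda : fps {poly C} :=
  (fps_const (1 - lambda%:P) / (fps_exp 1 - fps_const lambda%:P)) ^+ r
  * fps_exp 'X.

Definition frobenius_euler r n lambda : {poly C} :=
  n`!%:R * coeft (frobenius_euler_gf r lambda) n.

Fact frobenius_euler_den_unit lambda : lambda != 1 ->
  fps_exp 1 - fps_const lambda%:P \is a @GRing.unit (fps {poly C}).
Proof.
move=> lambda1; rewrite unfold_in /= /fps_unit /= expr0 fact0 divr1 -polyCB.
by rewrite rmorph_unit // unitfE subr_eq0 eq_sym.
Qed.

Fact frobenius_eulerE r lambda :
  frobenius_euler_gf r lambda =
  Fps (fun n => frobenius_euler r n lambda / n`!%:R).
Proof.
apply: fps_ext => n /=; rewrite /frobenius_euler [X in _ = X / _]mulrC mulrK //.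
by rewrite -polyC_natr rmorph_unit // unitfE Num.Theory.pnatr_eq0 -lt0n fact_gt0.
Qed.

(* Q(lambda): the smallest subfield of C containing lambda. *)
Definition Qadjoin lambda : {pred C} :=
  fun z => `[< forall S : {pred C}, divring_closed S -> lambda \in S -> z \in S >].

Definition poly_leq n lambda : {pred {poly C}} :=
  fun p => (p \is a polyOver (Qadjoin lambda)) && (size p <= n.+1)%N.

End FrobeniusEuler.

(* Main.v *)
From HB Require Import structures.
Require Import Defs.
From mathcomp Require Import all_boot all_order all_algebra.
From mathcomp Require Import reals complex.

Import GRing.Theory.
Local Open Scope ring_scope.

(** The order-r Frobenius-Euler polynomials are, up to the factor
[(1 - lambda)^r], the preimages of the monomials under an operator that
combines translations of the variable. Since translating x by j multiplies
[e^(xt)] by [e^(jt)] and leaves [((1 - lambda) / (e^t - lambda))^r] unchanged,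
the operator [p |-> \sum_j 'C(r, j) (- lambda)^(r - j) p(x + j)] acts on the
generating function as multiplication by
[\sum_j 'C(r, j) (- lambda)^(r - j) e^(jt) = (e^t - lambda)^r]. The product is
[(1 - lambda)^r e^(xt)], so the operator maps the n-th Frobenius-Euler
polynomial to [(1 - lambda)^r x^n] ([frobenius_euler_shift_sum]).

Applied to [p = \sum_k c_k H_k], the operator therefore gives
[(1 - lambda)^r \sum_k c_k x^k], and c_k is read off from the coefficient of
x^k. By Taylor's formula that coefficient of p(x + j) is [p^`(k).[j] / k!]
([coef_shift_poly]), whence the derivatives in the formula. *)

Lemma fps_const_is_zmod_morphism (K : comUnitRingType) :
  zmod_morphism (@fps_const K).
Proof. by move=> a b; apply: fps_ext => -[|n] //=; rewrite oppr0 addr0. Qed.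

Lemma coeft_constM (K : comUnitRingType) (a : K) (f : fps K) n :
  coeft (fps_const a * f) n = a * coeft f n.
Proof.
rewrite /= big_ord_recl /= subn0 big1 ?addr0 // => i _.
by rewrite mul0r.
Qed.

Lemma fps_const_is_monoid_morphism (K : comUnitRingType) :
  monoid_morphism (@fps_const K).
Proof.
split=> // a b; apply: fps_ext => n; rewrite coeft_constM /=.
by case: n => //=; rewrite mulr0.
Qed.

HB.instance Definition _ (K : comUnitRingType) :=
  GRing.isZmodMorphism.Build K (fps K) (@fps_const K)
    (@fps_const_is_zmod_morphism K).
HB.instance Definition _ (K : comUnitRingType) :=
  GRing.isMonoidMorphism.Build K (fps K) (@fps_const K)
    (@fps_const_is_monoid_morphism K).

Lemma exp_sub_fps_const (K : comUnitRingType) (f : fps K) (a : K) r :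
  (f - fps_const a) ^+ r =
  \sum_(j < r.+1) fps_const ('C(r, j)%:R * (- a) ^+ (r - j)) * f ^+ j.
Proof.
rewrite addrC exprDn; apply: eq_bigr => j _.
by rewrite mulr_natl rmorphMn rmorphXn rmorphN mulrnAl.
Qed.

Lemma coeft_sum (K : comUnitRingType) (I : Type) (s : seq I) (P : pred I)
    (F : I -> fps K) n :
  coeft (\sum_(i <- s | P i) F i) n = \sum_(i <- s | P i) coeft (F i) n.
Proof. exact: (big_morph (fun f : fps K => coeft f n)). Qed.

Definition map_fps {K L : comUnitRingType} (phi : K -> L) (f : fps K) : fps L :=
  Fps (fun n => phi (coeft f n)).

Section MapFps.
Variables (K L : comUnitRingType) (phi : {rmorphism K -> L}).

Lemma map_fps_is_zmod_morphism : zmod_morphism (map_fps phi).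
Proof. by move=> f g; apply: fps_ext => n /=; rewrite rmorphB. Qed.

Lemma map_fps_const a : map_fps phi (fps_const a) = fps_const (phi a).
Proof. by apply: fps_ext => -[|n] //=; rewrite rmorph0. Qed.

Lemma map_fps_is_monoid_morphism : monoid_morphism (map_fps phi).
Proof.
split=> [|f g]; first by rewrite [LHS]map_fps_const rmorph1.
apply: fps_ext => n /=; rewrite rmorph_sum.
by apply: eq_bigr => i _; rewrite rmorphM.
Qed.

HB.instance Definition _ :=
  GRing.isZmodMorphism.Build (fps K) (fps L) (map_fps phi)
    map_fps_is_zmod_morphism.
HB.instance Definition _ :=
  GRing.isMonoidMorphism.Build (fps K) (fps L) (map_fps phi)
    map_fps_is_monoid_morphism.

(** Factorials must be units for phi to commute with the divisions: on a
non-unit, division is a default operation that phi need not respect. *)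
Lemma map_fps_exp a : (forall n, (n`!%:R : K) \is a GRing.unit) ->
  map_fps phi (fps_exp a) = fps_exp (phi a).
Proof.
move=> Ufact; apply: fps_ext => n /=.
by rewrite rmorph_div // rmorphXn rmorph_nat.
Qed.

End MapFps.

Section FpsExp.
Variable K : comUnitRingType.
Hypothesis Ufact : forall n, (n`!%:R : K) \is a GRing.unit.

Lemma fps_expD (a b : K) : fps_exp (a + b) = fps_exp a * fps_exp b.
Proof.
apply: fps_ext => n /=; rewrite addrC exprDn mulr_suml.
apply: eq_bigr => i _; have le_in : (i <= n)%N by rewrite -ltnS.
(* The binomial coefficient of the expansion of [(b + a)^n] splits [1 / n!]. *)
have bin_div : 'C(n, i)%:R / n`!%:R = i`!%:R^-1 * (n - i)`!%:R^-1 :> K.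
  apply: (mulIr (Ufact n)); rewrite divrK // -(bin_fact le_in) !natrM.
  by rewrite mulrCA mulrACA !mulVr // !mulr1.
by rewrite mulrACA -bin_div -[_ *+ _]mulr_natr [RHS]mulrA [a ^+ _ * _]mulrC.
Qed.

Lemma fps_exp0 : fps_exp (0 : K) = 1.
Proof. by apply: fps_ext => -[|n] /=; rewrite ?divr1 // expr0n mul0r. Qed.

Lemma fps_exp_nat j : fps_exp (j%:R : K) = fps_exp 1 ^+ j.
Proof.
elim: j => [|j IHj]; first by rewrite fps_exp0.
by rewrite -addn1 natrD fps_expD IHj exprD.
Qed.

End FpsExp.

(** Translation commutes with differentiation, so both sides are the k-th
derivative of the translated polynomial at 0. Stated with the factor k!, this
form of Taylor's formula holds in every characteristic. *)
Lemma coef_shift_poly (A : comNzRingType) (p : {poly A}) (c : A) k :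
  (p \Po ('X + c%:P))`_k *+ k`! = (p^`(k)).[c].
Proof.
have ->: (p^`(k)).[c] = ((p \Po ('X + c%:P))^`(k)).[0].
  suff ->: (p \Po ('X + c%:P))^`(k) = p^`(k) \Po ('X + c%:P).
    by rewrite horner_comp !hornerE.
  elim: k => // k IHk.
  by rewrite !derivnS IHk deriv_comp derivD derivX derivC addr0 mulr1.
by rewrite horner_coef0 coef_derivn addn0 ffactnn.
Qed.

Section FrobeniusEulerShift.
Variables (R : realType) (lambda : R[i]).
Hypothesis lambda_neq1 : lambda != 1.

Lemma fact_polyC_unit n : (n`!%:R : {poly R[i]}) \is a GRing.unit.
Proof.
by rewrite -polyC_natr rmorph_unit // unitfE Num.Theory.pnatr_eq0 -lt0n fact_gt0.
Qed.

(** The coefficients of [(1 - lambda) / (e^t - lambda)] do not involve x, so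
translating x only affects the factor [e^(xt)]. *)
Lemma frobenius_euler_gf_shift r j :
  map_fps (comp_poly ('X + (j%:R)%:P)) (frobenius_euler_gf r lambda) =
  fps_exp 1 ^+ j * frobenius_euler_gf r lambda.
Proof.
pose phi : {rmorphism {poly R[i]} -> {poly R[i]}} :=
  comp_poly ('X + (j%:R)%:P).
have phi_const a : map_fps phi (fps_const a%:P) = fps_const a%:P.
  by rewrite map_fps_const; congr fps_const; apply: comp_polyC.
have phi_exp a : map_fps phi (fps_exp a) = fps_exp (phi a).
  by apply: map_fps_exp; apply: fact_polyC_unit.
have phi_X : phi 'X = 'X + j%:R by rewrite -polyC_natr; apply: comp_polyX.
rewrite -[comp_poly _]/(phi : _ -> _) /frobenius_euler_gf.
rewrite -polyCB rmorphM rmorphXn.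
rewrite rmorph_div ?frobenius_euler_den_unit //= [map_fps phi (_ - _)]rmorphB /=.
rewrite !phi_const !phi_exp phi_X rmorph1.
rewrite fps_expD ?fps_exp_nat; try exact: fact_polyC_unit.
by rewrite mulrA mulrC.
Qed.

(** By the binomial formula, the translates of the generating function combine
to its product by [(e^t - lambda)^r], which cancels the denominator. *)
Lemma frobenius_euler_shift_sum r n :
  \sum_(j < r.+1) ('C(r, j)%:R * (- lambda) ^+ (r - j))
     *: (frobenius_euler r n lambda \Po ('X + (j%:R)%:P)) =
  (1 - lambda) ^+ r *: 'X^n.
Proof.
set gf := frobenius_euler_gf r lambda.
have shift_sum_gf : \sum_(j < r.+1)
    fps_const ('C(r, j)%:R * (- lambda%:P) ^+ (r - j))
    * map_fps (comp_poly ('X + (j%:R)%:P)) gf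
  = fps_const ((1 - lambda%:P) ^+ r) * fps_exp 'X.
  transitivity ((fps_exp 1 - fps_const lambda%:P) ^+ r * gf).
    rewrite exp_sub_fps_const mulr_suml; apply: eq_bigr => j _.
    by rewrite frobenius_euler_gf_shift mulrA.
  rewrite rmorphXn /gf /frobenius_euler_gf mulrA -exprMn.
  congr (_ ^+ r * _); rewrite mulrC divrK //.
  exact: frobenius_euler_den_unit.
(* Compare the coefficients of [t^n / n!] on both sides. *)
have := congr1 (fun f => n`!%:R * coeft f n) shift_sum_gf.
rewrite coeft_constM coeft_sum mulr_sumr mulrCA.
rewrite [X in _ = _ * X]mulrC [X in _ = _ * X]divrK ?fact_polyC_unit //.
rewrite -mul_polyC rmorphXn rmorphB rmorph1 => <-; apply: eq_bigr => j _.
rewrite coeft_constM mulrCA -mul_polyC rmorphM rmorph_nat rmorphXn rmorphN.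
by rewrite /frobenius_euler rmorphM rmorph_nat.
Qed.

End FrobeniusEulerShift.

Theorem theorem1 (R : realType) (lambda : R[i]) (n r : nat)
    (p : {poly R[i]}) (c : 'I_n.+1 -> R[i])
    (lambda_neq1 : lambda != 1)
    (p_in : p \in poly_leq n lambda)
    (c_in : forall k : 'I_n.+1, c k \in Qadjoin lambda)
    (p_eq : p = \sum_(k < n.+1) c k *: frobenius_euler r k lambda) :
  forall k : 'I_n.+1,
    c k = 1 / (k`!%:R * (1 - lambda) ^+ r)
          * \sum_(j < r.+1)
              'C(r, j)%:R * (- lambda) ^+ (r - j) * (p^`(k)).[j%:R].
Proof.
move=> k.
have shift_sum_p : \sum_(j < r.+1) ('C(r, j)%:R * (- lambda) ^+ (r - j))
      *: (p \Po ('X + (j%:R)%:P))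
    = (1 - lambda) ^+ r *: \sum_(i < n.+1) c i *: 'X^i.
  rewrite scaler_sumr; under [RHS]eq_bigr do rewrite scalerA mulrC -scalerA
    -(frobenius_euler_shift_sum R lambda lambda_neq1) scaler_sumr.
  rewrite exchange_big; apply: eq_bigr => j _.
  rewrite p_eq raddf_sum scaler_sumr; apply: eq_bigr => i _.
  by rewrite /= comp_polyZ !scalerA [c i * _]mulrC.
have coef_k : (\sum_(i < n.+1) c i *: 'X^i : {poly R[i]})`_k = c k.
  rewrite coef_sum (bigD1 k) //= coefZ coefXn eqxx mulr1 big1 ?addr0 //.
  move=> i ne_ik.
  by rewrite coefZ coefXn eq_sym val_eqE (negPf ne_ik) mulr0.
have ->: \sum_(j < r.+1) 'C(r, j)%:R * (- lambda) ^+ (r - j) * (p^`(k)).[j%:R]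
    = k`!%:R * (1 - lambda) ^+ r * c k.
  rewrite -coef_k -mulrA -coefZ -shift_sum_p coef_sum mulr_sumr.
  apply: eq_bigr => j _.
  by rewrite coefZ -coef_shift_poly -[_ *+ k`!]mulr_natl mulrCA.
rewrite mul1r mulKf // mulf_neq0 //.
  by rewrite Num.Theory.pnatr_eq0 -lt0n fact_gt0.
by rewrite expf_neq0 // subr_eq0 eq_sym.
Qed.
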